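(* The set $G=\{\gamma(\mathcal{P}):\mathcal{P}\text{ is a finite subset of primes}\}$ is dense in $[\Gamma,\infty)$, where $\Gamma=\inf G$.
   Context: For a finite set $\mathcal{P}$ of primes (possibly empty), let $1_{\mathcal{P}}(n)=1$ if $\gcd\big(n,\prod_{p\in\mathcal{P}}p\big)=1$ and $1_{\mathcal{P}}(n)=0$ otherwise, and let $\delta_{\mathcal{P}}=\lim_{x\to\infty}\frac1x\sum_{n\le x}1_{\mathcal{P}}(n)=\prod_{p\in\mathcal{P}}(1-1/p)$. The generalized Euler constant of $\mathcal{P}$ is $$\gamma(\mathcal{P})=\lim_{x\to\infty}\Big\{\sum_{n\le x}\frac{1_{\mathcal{P}}(n)}{n}-\delta_{\mathcal{P}}\log x\Big\}$$ (the limit exists). *)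

(* Defs.v *)
From HB Require Import structures.
From mathcomp Require Import all_boot all_order all_algebra.
From mathcomp Require Import finmap.
From mathcomp Require Import all_classical all_reals all_analysis.

Set Implicit Arguments.
Unset Strict Implicit.
Unset Printing Implicit Defensive.

Import Order.TTheory GRing.Theory Num.Theory.
Import numFieldNormedType.Exports.

Local Open Scope classical_set_scope.
Local Open Scope ring_scope.

Definition prime_set (P : {fset nat}) : Prop := forall p, p \in P -> prime p.

Definition ind_coprime (P : {fset nat}) (n : nat) : bool :=
  coprime n (\prod_(p <- P) p)%N.

(* Sums over the positive integers n <= x, for real x >= 0, are written
   \sum_(1 <= n < (Num.truncn x).+1). *)

Definition delta (R : realType) (P : {fset nat}) : R :=
  lim (x^-1 * (\sum_(1 <= n < (Num.truncn x).+1) (ind_coprime P n)%:R)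
       @[x --> +oo_R]).

Definition gen_euler_const (R : realType) (P : {fset nat}) : R :=
  lim ((\sum_(1 <= n < (Num.truncn x).+1) (ind_coprime P n)%:R / n%:R)
         - delta R P * ln x
       @[x --> +oo_R]).

Definition gen_euler_consts (R : realType) : set R :=
  [set gen_euler_const R P | P in [set P | prime_set P]].
Arguments gen_euler_consts : clear implicits.

Definition dense_in (T : topologicalType) (A B : set T) : Prop :=
  A `<=` B /\ B `<=` closure A.

(* Main.v *)
Require Import Defs.
From mathcomp Require Import all_boot all_order all_algebra.
From mathcomp Require Import finmap.
From mathcomp Require Import all_classical all_reals all_analysis.
From mathcomp Require Import ring lra.
Import Order.TTheory GRing.Theory Num.Theory.
Import numFieldNormedType.Exports.
Local Open Scope classical_set_scope.
Local Open Scope ring_scope.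

(** Write D(P) for the product of 1 - 1/p over p in P, and g(P) for the
    generalized Euler constant.

    Removing the multiples of a new prime p from the integers coprime to P
    gives A_(P+p)(x) = A_P(x) - A_P(x/p)/p for the sums A_P(x) of 1/n over the
    n <= x coprime to P.  Hence, by induction on P, the limit defining g(P)
    exists, the density is D(P), and
        g(P+p) = (1 - 1/p) g(P) + D(P) ln p / p
    ([gen_euler_const_add_prime]).  As g of the empty set is the
    Euler-Mascheroni constant, all g(P) are nonnegative, so the infimum exists,
    and adding p raises g by at most ln p / p, which is small when p is large.

    It remains to show that from any P, adding only large primes, g can be
    raised above any given y: if g(P) < y and the primes p > N are added in
    increasing order, N being large, the first value of g above y then exceeds
    it by less than e ([gen_euler_const_just_above]).  Let w be the product of
    1 - 1/p over the primes added so far.  The recursion and ln p >= ln N give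
        g >= D(P) ln N w (1 - w)
    ([gen_euler_const_add_primes_ge]).  Since w falls to 0 with steps of ratio
    at least 1/2, it passes through [1/4, 1/2], where this bound is at least
    D(P) ln N / 8, which is beyond y for N large.

    That w falls to 0 is Euler's theorem on primes, and comes from the same
    sieve identity: it yields A_Q(x) >= D(Q) H(x) with H the harmonic sum, while
    A_Q(x) = 1 when Q contains all primes up to x >= 1; so D(Q) <= 1 / H(x)
    ([sieve_prod_nat_small]).

    Density then follows by applying this to P with g(P) < x + e/2, for x at
    least the infimum, and y = x + e/2. *)

(** * Removing the multiples of a prime *)

Lemma ind_coprime_add_prime (P : {fset nat}) (p n : nat) :
  prime p -> p \notin P ->
  ind_coprime (p |` P)%fset n = ind_coprime P n && ~~ (p %| n)%N.
Proof.
move=> pp pP; rewrite /ind_coprime big_fsetU1 //= coprimeMr.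
by rewrite (coprime_sym n p) prime_coprime // andbC.
Qed.

Lemma coprime_prime_prod (P : {fset nat}) (p : nat) :
  prime_set P -> prime p -> p \notin P -> coprime p (\prod_(q <- P) q)%N.
Proof.
move=> PP pp pP; rewrite prime_coprime //.
apply/negP; rewrite big_seq; elim/big_rec: _ => [|q x qP IH].
  by rewrite dvdn1 => /eqP p1; rewrite p1 in pp.
rewrite Euclid_dvdM // => /orP[|//]; rewrite dvdn_prime2 ?(PP q) // => /eqP pq.
by rewrite pq qP in pP.
Qed.

Lemma ind_coprime_mul_prime (P : {fset nat}) (p n : nat) :
  prime_set P -> prime p -> p \notin P ->
  ind_coprime P (p * n) = ind_coprime P n.
Proof. by move=> PP pp pP; rewrite /ind_coprime coprimeMl coprime_prime_prod. Qed.

Lemma sum_multiples (R : nzRingType) (f : nat -> R) (d n : nat) : (0 < d)%N ->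
  \sum_(1 <= k < n.+1 | (d %| k)%N) f k = \sum_(1 <= k < (n %/ d).+1) f (d * k)%N.
Proof.
move=> d0; elim: n => [|n IH]; first by rewrite div0n !big_nil.
rewrite big_mkcond big_nat_recr //= -big_mkcond /= IH divnS //.
case: ifP => [dn|_]; last by rewrite addr0.
rewrite add1n [RHS]big_nat_recr //=; congr (_ + f _).
by rewrite -[(n %/ d).+1]add1n -[1%N]/(nat_of_bool true) -dn -divnS // mulnC divnK.
Qed.

(** The integers coprime to P that are lost when the prime p is added are the
    p * k with k coprime to P, because p is itself coprime to P. *)
Lemma coprime_sum_add_prime (R : nzRingType) (P : {fset nat}) (p n : nat)
    (f : nat -> R) : prime_set P -> prime p -> p \notin P ->
  \sum_(1 <= k < n.+1) (ind_coprime (p |` P)%fset k)%:R * f k =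
  \sum_(1 <= k < n.+1) (ind_coprime P k)%:R * f k -
  \sum_(1 <= k < (n %/ p).+1) (ind_coprime P k)%:R * f (p * k)%N.
Proof.
move=> PP pp pP; apply/eqP; rewrite eq_sym subr_eq; apply/eqP.
under [X in _ = _ + X]eq_bigr => k _ do rewrite -(ind_coprime_mul_prime P p) //.
rewrite -(@sum_multiples _ (fun k => (ind_coprime P k)%:R * f k)) ?prime_gt0 //.
rewrite [X in _ = _ + X]big_mkcond -big_split /=; apply: eq_bigr => k _.
rewrite ind_coprime_add_prime //.
by case: ifP => dk; rewrite ?andbF ?andbT ?mul0r ?add0r ?addr0.
Qed.

(** Makes the bound x / p on the cofactors k agree with the integer quotient
    that bounds them in [coprime_sum_add_prime]. *)
Lemma truncn_div (R : realType) (x : R) (p : nat) : 0 <= x -> (0 < p)%N ->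
  Num.truncn (x / p%:R) = (Num.truncn x %/ p)%N.
Proof.
move=> x0 p0; have pR : 0 < p%:R :> R by rewrite ltr0n.
have /andP[h1 h2] := truncn_itv x0.
apply: truncn_def; rewrite ler_pdivlMr // ltr_pdivrMr // -!natrM; apply/andP; split.
  by apply: le_trans h1; rewrite ler_nat leq_trunc_div.
by apply: (lt_le_trans h2); rewrite ler_nat ltn_ceil.
Qed.

(** * Existence of the limits *)

Definition sieve_prod (R : realType) (P : {fset nat}) : R :=
  \prod_(p <- P) (1 - p%:R^-1).

Definition coprime_count {R : realType} (P : {fset nat}) (x : R) : R :=
  \sum_(1 <= n < (Num.truncn x).+1) (ind_coprime P n)%:R.

Definition coprime_harmonic {R : realType} (P : {fset nat}) (x : R) : R :=
  \sum_(1 <= n < (Num.truncn x).+1) (ind_coprime P n)%:R / n%:R.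

Section Limits.
Context {R : realType}.
Implicit Types (P : {fset nat}) (p n : nat) (x : R).

Lemma coprime_count_add_prime P p x :
  0 <= x -> prime_set P -> prime p -> p \notin P ->
  coprime_count (p |` P)%fset x = coprime_count P x - coprime_count P (x / p%:R).
Proof.
move=> x0 PP pp pP; rewrite /coprime_count truncn_div ?prime_gt0 //.
have /= := @coprime_sum_add_prime R P p (Num.truncn x) (fun=> 1) PP pp pP.
by rewrite !(eq_bigr _ (fun _ _ => mulr1 _)).
Qed.

Lemma coprime_harmonic_add_prime P p x :
  0 <= x -> prime_set P -> prime p -> p \notin P ->
  coprime_harmonic (p |` P)%fset x =
  coprime_harmonic P x - p%:R^-1 * coprime_harmonic P (x / p%:R).
Proof.
move=> x0 PP pp pP; rewrite /coprime_harmonic truncn_div ?prime_gt0 //.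
rewrite (@coprime_sum_add_prime R P p _ (fun k => k%:R^-1)) //; congr (_ - _).
rewrite big_distrr /=; apply: eq_bigr => k _; rewrite natrM invfM; ring.
Qed.

Lemma ind_coprime0 n : ind_coprime fset0 n.
Proof. by rewrite /ind_coprime big_seq_fset0 coprimen1. Qed.

Lemma prime_set_ind (Q : {fset nat} -> Prop) : Q fset0 ->
  (forall p P, prime p -> p \notin P -> prime_set P -> Q P -> Q (p |` P)%fset) ->
  forall P, prime_set P -> Q P.
Proof.
move=> Q0 QS; apply: fset1U_rect => // p P pP IH PP.
have PP' : prime_set P by move=> q qP; apply: PP; rewrite in_fset1U qP orbT.
by apply: QS => //; [apply: PP; rewrite in_fset1U eqxx | apply: IH].
Qed.

Lemma cvg_divy (p : nat) : (0 < p)%N -> x / p%:R @[x --> +oo_R] --> +oo_R.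
Proof.
by move=> p0; apply: gt0_cvgMly; [rewrite invr_gt0 ltr0n | exact: cvg_id].
Qed.

Lemma cvg_truncny : Num.truncn x @[x --> +oo_R] --> \oo.
Proof.
apply/cvgnyPge => A; near=> x.
have x0 : A%:R <= x by near: x; apply: nbhs_pinfty_ge; rewrite num_real.
by rewrite truncn_ge_nat ?(le_trans _ x0).
Unshelve. all: by end_near. Qed.

(** The sieve identity divided by x sends the limit d to d - d / p. *)
Lemma count_density_cvg P : prime_set P ->
  x^-1 * coprime_count P x @[x --> +oo_R] --> sieve_prod R P.
Proof.
move: P; apply: prime_set_ind => [|p P pp pP PP IH].
  rewrite /sieve_prod big_seq_fset0.
  apply: (@squeeze_cvgr _ _ _ _ (fun x => 1 - x^-1) (fun=> 1)); last first.
  - exact: cvg_cst.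
  - rewrite -[X in _ --> X]subr0; apply: cvgB; first exact: cvg_cst.
    by apply/gtr0_cvgV0; [near=> x; near: x; apply: nbhs_pinfty_gt; rewrite num_real
        | exact: cvg_id].
  near=> x.
  have x0 : 0 < x by near: x; apply: nbhs_pinfty_gt; rewrite num_real.
  have -> : coprime_count fset0 x = (Num.truncn x)%:R.
    rewrite /coprime_count (eq_bigr (fun=> 1)) => [|k _]; last by rewrite ind_coprime0.
    by rewrite sumr_const_nat subn1.
  have /andP[h1 h2] := truncn_itv (ltW x0).
  rewrite mulrC ler_pdivlMr // ler_pdivrMr // mul1r h1 andbT mulrBl mulVf ?gt_eqF //.
  by rewrite mul1r lerBlDr natr1 ltW.
rewrite /sieve_prod big_fsetU1 //= mulrBl mul1r -/(sieve_prod R P).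
have p0 : p%:R != 0 :> R by rewrite pnatr_eq0 -lt0n prime_gt0.
have IHp := cvg_comp _ _ (cvg_divy _ (prime_gt0 pp)) IH.
apply: (@cvg_trans _ ((x^-1 * coprime_count P x -
   p%:R^-1 * ((x / p%:R)^-1 * coprime_count P (x / p%:R))) @[x --> +oo_R])); last first.
  by apply: cvgB => //; apply: cvgMr; exact: IHp.
apply: near_eq_cvg; near=> x.
have x0 : 0 < x by near: x; apply: nbhs_pinfty_gt; rewrite num_real.
rewrite coprime_count_add_prime ?(ltW x0) //.
have := gt_eqF x0 => /negbT x00.
by field; rewrite x00 p0.
Unshelve. all: by end_near. Qed.

Lemma deltaE P : prime_set P -> delta R P = sieve_prod R P.
Proof. by move=> /count_density_cvg/cvg_lim; apply; apply: Rhausdorff. Qed.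

Lemma ln_succ_le n : ln n.+2%:R - ln n.+1%:R <= n.+1%:R^-1 :> R.
Proof.
rewrite -ln_div ?posrE ?ltr0n //.
have -> : n.+2%:R / n.+1%:R = 1 + n.+1%:R^-1 :> R.
  by rewrite -[n.+2]addn1 natrD mulrDl divff ?pnatr_eq0 // mul1r.
by apply: le_ln1Dx; rewrite (lt_le_trans (ltrN10 _)) // invr_ge0 ler0n.
Qed.

Lemma ln_succ_ge n : n.+2%:R^-1 <= ln n.+2%:R - ln n.+1%:R :> R.
Proof.
rewrite -lerN2 opprB -ln_div ?posrE ?ltr0n //.
have -> : n.+1%:R / n.+2%:R = 1 + - n.+2%:R^-1 :> R.
  rewrite -[X in 1 - X]mul1r -[X in X - _](@divff _ n.+2%:R) ?pnatr_eq0 // -mulrBl.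
  by congr (_ / _); rewrite -[n.+2]addn1 natrD addrK.
by apply: le_ln1Dx; rewrite ltrN2 invf_lt1 ?ltr0n // ltr1n.
Qed.

Definition harmonic_sum n : R := \sum_(1 <= k < n.+1) k%:R^-1.

Lemma harmonic_sumS n : harmonic_sum n.+1 = harmonic_sum n + n.+1%:R^-1.
Proof. by rewrite /harmonic_sum big_nat_recr. Qed.

Lemma ln_le_harmonic_sum n : ln n.+1%:R <= harmonic_sum n.
Proof.
elim: n => [|n IH]; first by rewrite ln1 /harmonic_sum big_nil.
by rewrite harmonic_sumS -lerBlDl (le_trans _ (ln_succ_le n)) // lerD2l lerN2.
Qed.

Lemma coprime_harmonic0 x : coprime_harmonic fset0 x = harmonic_sum (Num.truncn x).
Proof. by apply: eq_bigr => k _; rewrite ind_coprime0 mul1r. Qed.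

(** With t the integer part of x, monotonicity of ln squeezes H(t) - ln x
    between H(t) - ln (t + 1) and H(t) - ln t, two sequences with the same
    limit. *)
Lemma euler_mascheroni_cvg :
  exists2 g : R, 0 <= g & coprime_harmonic fset0 x - ln x @[x --> +oo_R] --> g.
Proof.
(* The index is shifted because ln 0 = 0 would break monotonicity at 0. *)
pose u n := harmonic_sum n.+1 - ln n.+1%:R.
have u_ge n : n.+1%:R^-1 <= u n.
  rewrite /u harmonic_sumS addrAC -lerBlDr subrr subr_ge0.
  exact: ln_le_harmonic_sum.
have u_dec : {homo u : n m / (n <= m)%N >-> m <= n}.
  apply/nonincreasing_seqP => n; rewrite /u (harmonic_sumS n.+1).
  move: (ln_succ_ge n); move: (ln _) (ln _) (_^-1) (harmonic_sum _) => a b c d; lra.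
have u_cvg : cvgn u.
  apply: nonincreasing_is_cvgn => //; exists 0 => _ [n _ <-].
  by rewrite (le_trans _ (u_ge n)) // invr_ge0 ler0n.
exists (limn u).
  apply: limr_ge => //; apply: nearW => n.
  by rewrite (le_trans _ (u_ge n)) // invr_ge0 ler0n.
pose t x := (Num.truncn x).-1.
have t_cvg : t x @[x --> +oo_R] --> \oo.
  apply: (cvg_comp _ _ cvg_truncny); apply/cvgnyPge => A; near=> n.
  by rewrite -ltnS prednK; [near: n; exact: nbhs_infty_gt
    |apply: (@leq_ltn_trans A) => //; near: n; exact: nbhs_infty_gt].
apply: (@squeeze_cvgr _ _ _ _ (fun x => u (t x).+1 - harmonic (t x).+1)
          (fun x => u (t x))); last first.
- exact: (cvg_comp _ _ t_cvg u_cvg).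
- rewrite -[X in _ --> X]subr0; apply: cvgB.
    by apply: (cvg_comp _ (fun n => u n.+1) t_cvg); rewrite (cvg_shiftS u).
  apply: (cvg_comp _ (fun n => @harmonic R n.+1) t_cvg).
  by rewrite (cvg_shiftS (@harmonic R : nat -> R)); exact: cvg_harmonic.
near=> x.
have x1 : 1 <= x by near: x; apply: nbhs_pinfty_ge; rewrite num_real.
have x0 : 0 < x by apply: lt_le_trans x1.
have tE : Num.truncn x = (t x).+1 by rewrite /t prednK // truncn_gt0.
rewrite coprime_harmonic0 tE /u /=.
have /andP[h1 h2] := truncn_itv (ltW x0); rewrite tE in h1 h2.
rewrite lerD2l lerN2 ler_ln ?posrE ?ltr0n // h1 andbT.
rewrite (harmonic_sumS (t x).+1) addrAC addrK lerD2l lerN2.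
by rewrite ler_ln ?posrE ?ltr0n // ltW.
Unshelve. all: by end_near. Qed.

Definition euler_defect P (x : R) := coprime_harmonic P x - delta R P * ln x.

(** For x > 0 the new defect at x is exactly the old one at x, minus 1/p times
    the old one at x / p, plus delta * ln p / p: this last term is what remains
    of the logarithms, as ln (x / p) = ln x - ln p. *)
Lemma euler_defect_add_prime P p (g : R) : prime_set P -> prime p -> p \notin P ->
  euler_defect P x @[x --> +oo_R] --> g ->
  euler_defect (p |` P)%fset x @[x --> +oo_R] -->
    (1 - p%:R^-1) * g + delta R P * (ln p%:R / p%:R).
Proof.
move=> PP pp pP gP.
have p0 := prime_gt0 pp.
have pn0 : p%:R != 0 :> R by rewrite pnatr_eq0 -lt0n.
have PP' : prime_set (p |` P)%fset.
  by move=> q; rewrite in_fset1U => /orP[/eqP->|/PP].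
have gPp := cvg_comp _ _ (cvg_divy _ p0) gP.
apply: (@cvg_trans _ ((euler_defect P x - p%:R^-1 * euler_defect P (x / p%:R) +
   delta R P * (ln p%:R / p%:R)) @[x --> +oo_R])); last first.
  apply: cvgD; last exact: cvg_cst.
  rewrite mulrBl mul1r; apply: cvgB => //; apply: cvgMr; exact: gPp.
apply: near_eq_cvg; near=> x.
have x0 : 0 < x by near: x; apply: nbhs_pinfty_gt; rewrite num_real.
rewrite /euler_defect coprime_harmonic_add_prime ?(ltW x0) //.
rewrite !deltaE // /sieve_prod big_fsetU1 //= ln_div ?posrE ?ltr0n //.
by field.
Unshelve. all: by end_near. Qed.

Lemma sieve_prod_add_prime P p : p \notin P ->
  sieve_prod R (p |` P)%fset = (1 - p%:R^-1) * sieve_prod R P.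
Proof. by move=> pP; rewrite /sieve_prod big_fsetU1. Qed.

Lemma sieve_factor_gt0 p : prime p -> 0 < 1 - p%:R^-1 :> R.
Proof.
by move=> pp; rewrite subr_gt0 invf_lt1 ?ltr0n ?prime_gt0 // ltr1n prime_gt1.
Qed.

Lemma sieve_prod_itv P : prime_set P -> 0 < sieve_prod R P <= 1.
Proof.
move: P; apply: prime_set_ind => [|p P pp pP PP /andP[IH1 IH2]].
  by rewrite /sieve_prod big_seq_fset0 ltr01 lexx.
rewrite sieve_prod_add_prime // mulr_gt0 ?sieve_factor_gt0 //=.
have f0 := sieve_factor_gt0 _ pp.
by rewrite mulr_ile1 ?(ltW f0) ?(ltW IH1) // gerBl invr_ge0 ler0n.
Qed.

Lemma euler_defect_cvg_ge0 P : prime_set P ->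
  exists2 g : R, 0 <= g & euler_defect P x @[x --> +oo_R] --> g.
Proof.
move: P; apply: prime_set_ind => [|p P pp pP PP [g g0 gP]].
  have P0 : prime_set fset0 by move=> q; rewrite in_fset0.
  have [g g0 hg] := euler_mascheroni_cvg; exists g => //.
  rewrite /euler_defect deltaE // /sieve_prod big_seq_fset0.
  by under eq_fun do rewrite mul1r.
eexists; last exact: euler_defect_add_prime gP.
have /andP[d0 _] := sieve_prod_itv _ PP.
rewrite addr_ge0 ?mulr_ge0 ?invr_ge0 ?ler0n ?(ltW (sieve_factor_gt0 _ pp)) //.
  by rewrite deltaE // ltW.
by rewrite ln_ge0 // ler1n prime_gt0.
Qed.

Lemma gen_euler_const_cvg P : prime_set P ->
  euler_defect P x @[x --> +oo_R] --> gen_euler_const R P.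
Proof.
by move=> /euler_defect_cvg_ge0[g _ gP]; apply/cvg_ex; exists g.
Qed.

Lemma gen_euler_const_ge0 P : prime_set P -> 0 <= gen_euler_const R P.
Proof.
move=> /euler_defect_cvg_ge0[g g0 gP].
by rewrite /gen_euler_const (cvg_lim _ gP) //; apply: Rhausdorff.
Qed.

Lemma gen_euler_const_add_prime P p : prime_set P -> prime p -> p \notin P ->
  gen_euler_const R (p |` P)%fset =
  (1 - p%:R^-1) * gen_euler_const R P + sieve_prod R P * (ln p%:R / p%:R).
Proof.
move=> PP pp pP; rewrite -deltaE //; apply: cvg_lim; first exact: Rhausdorff.
by apply: euler_defect_add_prime => //; exact: gen_euler_const_cvg.
Qed.

(** * Euler's theorem: the products of 1 - 1/p tend to 0 *)

Lemma le_coprime_harmonic P x y : x <= y ->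
  coprime_harmonic P x <= coprime_harmonic P y.
Proof.
move=> xy; rewrite /coprime_harmonic.
have le_xy : ((Num.truncn x).+1 <= (Num.truncn y).+1)%N by rewrite ltnS le_truncn.
rewrite (big_cat_nat (ltn0Sn _) le_xy) //= lerDl; apply: sumr_ge0.
by move=> k _; rewrite divr_ge0 ?ler0n.
Qed.

(** Removing the multiples of p costs A_P(x/p)/p, at most the proportion 1/p
    of A_P(x). *)
Lemma coprime_harmonic_ge P x : 0 <= x -> prime_set P ->
  sieve_prod R P * harmonic_sum (Num.truncn x) <= coprime_harmonic P x.
Proof.
move=> x0; move: P; apply: prime_set_ind => [|p P pp pP PP IH].
  by rewrite coprime_harmonic0 /sieve_prod big_seq_fset0 mul1r.
rewrite coprime_harmonic_add_prime // sieve_prod_add_prime // -mulrA.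
apply: (@le_trans _ _ ((1 - p%:R^-1) * coprime_harmonic P x)).
  by rewrite ler_pM2l ?sieve_factor_gt0.
rewrite mulrBl mul1r lerD2l lerN2 ler_wpM2l ?invr_ge0 ?ler0n //.
apply: le_coprime_harmonic; rewrite ler_pdivrMr ?ltr0n ?prime_gt0 //.
by rewrite ler_peMr // ler1n prime_gt0.
Qed.

(** Every n > 1 is divisible by its smallest prime factor, so only the term
    n = 1 survives. *)
Lemma coprime_harmonic_all_primes P n :
  (forall p, prime p -> (p <= n)%N -> p \in P) ->
  coprime_harmonic P (n%:R : R) <= 1.
Proof.
move=> allP; rewrite /coprime_harmonic natrK.
case: n allP => [|n] allP; first by rewrite big_nil ler01.
rewrite big_ltn // big_nat big1 => [|k /andP[k1 kn]].
  by rewrite addr0 divr1 lern1 leq_b1.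
have kP : pdiv k \in P.
  by apply: allP; rewrite ?pdiv_prime // (leq_trans (pdiv_leq _)) // ltnW.
rewrite /ind_coprime (_ : coprime _ _ = false) ?mul0r //.
apply/negP => /(coprime_dvdl (pdiv_dvd k)).
by rewrite prime_coprime ?pdiv_prime // (big_fsetD1 _ kP) /= dvdn_mulr.
Qed.

(** Adds to P the primes in (N, N + k].  The recursion on k exposes one
    candidate at a time, so that g can be followed step by step. *)
Fixpoint add_primes P (N k : nat) : {fset nat} :=
  if k is k'.+1 then
    let Q := add_primes P N k' in
    if prime (N + k)%N then ((N + k)%N |` Q)%fset else Q
  else P.

Lemma add_primes_prime_set P N k : prime_set P -> prime_set (add_primes P N k).
Proof.
move=> PP; elim: k => //= k IH; case: ifP => // pp q.
by rewrite in_fset1U => /orP[/eqP->|/IH].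
Qed.

Lemma add_primes_le P N k q : (forall q, q \in P -> (q <= N)%N) ->
  q \in add_primes P N k -> (q <= N + k)%N.
Proof.
move=> PN; elim: k q => [q /PN|k IH q /=]; first by rewrite addn0.
have IH' : q \in add_primes P N k -> (q <= N + k.+1)%N.
  by move=> /IH h; rewrite (leq_trans h) // addnS.
by case: ifP => // _; rewrite in_fset1U => /orP[/eqP->|].
Qed.

Lemma add_primes_new P N k : (forall q, q \in P -> (q <= N)%N) ->
  (N + k.+1)%N \notin add_primes P N k.
Proof.
by move=> PN; apply/negP => /(add_primes_le _ _ _ _ PN); rewrite addnS ltnn.
Qed.

Lemma mem_add_primes P N k p : prime p -> (N < p <= N + k)%N ->
  p \in add_primes P N k.
Proof.
move=> pp; elim: k => [|k IH]; first by rewrite addn0 ltnNge andNb.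
rewrite [(p <= _)%N]leq_eqVlt addnS ltnS => /andP[Np /orP[/eqP pE|pk]] /=.
  by rewrite addnS -pE pp in_fset1U eqxx.
have Q := IH (introT andP (conj Np pk)).
by case: ifP => // _; rewrite in_fset1U Q orbT.
Qed.

Definition sieve_prod_nat (m n : nat) : R :=
  \prod_(m <= p < n | prime p) (1 - p%:R^-1).

Lemma sieve_prod_natS m n : (m <= n)%N ->
  sieve_prod_nat m n.+1 =
  (if prime n then 1 - n%:R^-1 else 1) * sieve_prod_nat m n.
Proof.
by move=> mn; rewrite /sieve_prod_nat big_mkcond big_nat_recr //= -big_mkcond mulrC.
Qed.

Lemma sieve_prod_nat_gt0 m n : 0 < sieve_prod_nat m n.
Proof. by rewrite /sieve_prod_nat prodr_gt0 // => p; exact: sieve_factor_gt0. Qed.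

Lemma sieve_prod_nat_le1 m n : sieve_prod_nat m n <= 1.
Proof.
rewrite /sieve_prod_nat prodr_ile1 // => p pp.
by rewrite (ltW (sieve_factor_gt0 p pp)) gerBl invr_ge0 ler0n.
Qed.

Lemma sieve_prod_add_primes P N k : (forall q, q \in P -> (q <= N)%N) ->
  sieve_prod R (add_primes P N k) = sieve_prod R P * sieve_prod_nat N.+1 (N + k).+1.
Proof.
move=> PN; elim: k => [|k IH]; first by rewrite addn0 /sieve_prod_nat big_geq // mulr1.
rewrite sieve_prod_natS addnS ?leq_addr //= addnS; case: ifP => _; last by rewrite mul1r.
by rewrite sieve_prod_add_prime ?IH 1?mulrCA // -addnS add_primes_new.
Qed.

Lemma near_ln_ge (A : R) : \forall n \near \oo, A <= ln n%:R.
Proof.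
near=> n.
have : expR A <= n%:R by near: n; exact: nbhs_infty_ger.
move=> h; rewrite -[A]expRK ler_ln ?posrE ?expR_gt0 //.
by apply: lt_le_trans h; exact: expR_gt0.
Unshelve. all: by end_near. Qed.

(** Apply [coprime_harmonic_ge] and [coprime_harmonic_all_primes] to the set of
    all primes up to N + k: its product is c times the one over (N, N + k],
    where c, the product up to N, does not depend on k. *)
Lemma sieve_prod_nat_small (N : nat) (e : R) : 0 < e ->
  exists k, sieve_prod_nat N.+1 (N + k).+1 <= e.
Proof.
move=> e0; pose c := sieve_prod_nat 1 N.+1.
have c0 : 0 < c by exact: sieve_prod_nat_gt0.
have [K _ hK] := near_ln_ge ((c * e)^-1).
exists K; have hKN : (c * e)^-1 <= harmonic_sum (N + K).
  by apply: le_trans (ln_le_harmonic_sum _); apply: hK; rewrite /= leqW ?leq_addl.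
have P0 : prime_set fset0 by move=> q; rewrite in_fset0.
have hA := @coprime_harmonic_ge (add_primes fset0 0 (N + K)) (N + K)%:R
  (ler0n _ _) (add_primes_prime_set _ _ _ P0).
have {}hA := le_trans hA (coprime_harmonic_all_primes _ _
  (fun p pp pN => mem_add_primes _ _ _ _ pp (introT andP (conj (prime_gt0 pp) pN)))).
rewrite sieve_prod_add_primes in hA; last by move=> q; rewrite in_fset0.
rewrite /sieve_prod big_seq_fset0 mul1r natrK add0n in hA.
have NK : (N.+1 <= (N + K).+1)%N by rewrite ltnS leq_addr.
rewrite /sieve_prod_nat (big_cat_nat (ltn0Sn _) NK) //= -!/(sieve_prod_nat _ _) -/c in hA.
set w := sieve_prod_nat N.+1 _ in hA *.
have w0 : 0 < w by exact: sieve_prod_nat_gt0.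
have ce0 : 0 < c * e by rewrite mulr_gt0.
have := le_trans (ler_wpM2l (ltW (mulr_gt0 c0 w0)) hKN) hA.
by rewrite ler_pdivrMr // mul1r ler_pM2l.
Qed.

(** * Crossing a level by adding large primes *)

(** The bound has this form because g >= D(P) w S for S the sum of ln p / p over
    the primes added, and S >= ln N (1 - w) as the sum of 1/p over these primes
    is at least 1 - w.  Both facts come at once from the recursion for g.
    Let W = (1 - 1/p) w be the product after adding p.  The induction step
    holds because (1 - 1/p) w (1 - w) + w / p exceeds W (1 - W) by
    (w / p) (1 - W), which is nonnegative. *)
Lemma gen_euler_const_add_primes_ge P N k : (0 < N)%N -> prime_set P ->
  (forall q, q \in P -> (q <= N)%N) ->
  let w := sieve_prod_nat N.+1 (N + k).+1 in
  sieve_prod R P * ln N%:R * (w * (1 - w)) <= gen_euler_const R (add_primes P N k).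
Proof.
move=> N0 PP PN /=; elim: k => [|k IH].
  rewrite addn0 /sieve_prod_nat big_geq // subrr !mulr0.
  exact: gen_euler_const_ge0.
rewrite sieve_prod_natS ?addnS ?ltnS ?leq_addr //= addnS.
case: ifP => pp; last by rewrite mul1r.
have new := add_primes_new P N k PN; rewrite addnS in new.
have QP := add_primes_prime_set P N k PP.
rewrite gen_euler_const_add_prime // sieve_prod_add_primes //.
set w := sieve_prod_nat _ _ in IH *; set p := (N + k).+1 in pp *.
set g := gen_euler_const R _ in IH *; set D := sieve_prod R P in IH *.
have /andP[D0 _] : 0 < D <= 1 by exact: sieve_prod_itv.
have w0 : 0 < w by exact: sieve_prod_nat_gt0.
have p1 := prime_gt0 pp.
have lnNp : ln N%:R <= ln p%:R :> R.
  by rewrite ler_ln ?posrE ?ltr0n // ler_nat /p leqW ?leq_addr.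
have l0 : 0 <= ln N%:R :> R by rewrite ln_ge0 // ler1n.
have f0 := sieve_factor_gt0 p pp.
have i0 : 0 < p%:R^-1 :> R by rewrite invr_gt0 ltr0n.
set l := ln N%:R in IH lnNp l0 *; set L := ln p%:R in lnNp *.
set i := p%:R^-1 in f0 i0 *.
have h1 : (1 - i) * (D * l * (w * (1 - w))) <= (1 - i) * g by rewrite ler_pM2l.
have h2 : D * w * (l * i) <= D * w * (L * i).
  by rewrite ler_pM2l ?mulr_gt0 // ler_pM2r.
apply: le_trans (lerD h1 h2).
rewrite -subr_ge0.
(* Here i = 1/p, so that (1 - i) * w is the new product. *)
rewrite [X in 0 <= X](_ : _ = D * l * w * i * (1 - (1 - i) * w)); last by ring.
apply: mulr_ge0; first by rewrite !mulr_ge0 // ltW.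
by rewrite subr_ge0 mulr_ile1 ?(ltW w0) ?(ltW f0) ?sieve_prod_nat_le1 // gerBl ltW.
Qed.

(** From ln n = 2 ln (sqrt n) < 2 sqrt n. *)
Lemma ln_div_small (e : R) : 0 < e -> \forall n \near \oo, ln n%:R / n%:R < e.
Proof.
move=> e0; near=> n.
have n0 : 0 < n%:R :> R by rewrite ltr0n; near: n; exact: nbhs_infty_gt.
have s0 : 0 < Num.sqrt n%:R :> R by rewrite sqrtr_gt0.
have nE : n%:R = Num.sqrt n%:R * Num.sqrt n%:R :> R by rewrite -expr2 sqr_sqrtr ?ltW.
rewrite ltr_pdivrMr // {1}nE lnM ?posrE //.
have h1 := ln_sublinear s0.
have h2 : 2 / e <= Num.sqrt n%:R.
  rewrite -ler_sqr ?nnegrE ?(ltW s0) ?divr_ge0 ?(ltW e0) // sqr_sqrtr ?(ltW n0) //.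
  by near: n; exact: nbhs_infty_ger.
rewrite ler_pdivrMr // in h2.
have h3 := ler_wpM2r (ltW s0) h2.
rewrite mulrAC -nE mulrC in h3.
lra.
Unshelve. all: by end_near. Qed.

(** Let N be large and add the primes above N one by one: the first value of g
    exceeding y is reached by a step of size less than e.  Such a value exists
    because the product w first drops to 1/2 or below from a value above 1/2, by
    a factor at least 1/2, hence lands in [1/4, 1/2]. *)
Lemma gen_euler_const_just_above P (y e : R) : prime_set P ->
  gen_euler_const R P < y -> 0 < e ->
  exists2 Q, prime_set Q & y < gen_euler_const R Q < y + e.
Proof.
move=> PP Py e0.
have /andP[D0 _] := sieve_prod_itv P PP.
(* The factor 8 comes from t (1 - t) >= 1/8 for t in [1/4, 1/2]. *)
have [N [N0 PN lnN hN]] : exists N, [/\ (0 < N)%N,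
    (forall q, q \in P -> (q <= N)%N),
    8 * y / sieve_prod R P < ln N%:R &
    forall p, (N < p)%N -> ln p%:R / p%:R < e :> R].
  have [K _ hK] := ln_div_small e e0.
  near \oo => N; exists N; split.
  - by near: N; exact: nbhs_infty_gt.
  - move=> q qP; rewrite (@leq_trans (\sum_(p <- P) p)) //.
      by rewrite (big_fsetD1 _ qP) /= leq_addr.
    by near: N; exact: nbhs_infty_ge.
  - apply: (@lt_le_trans _ _ (8 * y / sieve_prod R P + 1)); first by rewrite ltrDl.
    by near: N; exact: near_ln_ge.
  - move=> p Np; apply: hK => /=; apply: leq_trans (ltnW Np).
    by near: N; exact: nbhs_infty_ge.
pose g k := gen_euler_const R (add_primes P N k).
have gS k : g k.+1 <= g k \/ g k.+1 < g k + e.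
  rewrite /g /=; case: ifP => pp; last by left.
  right; rewrite gen_euler_const_add_prime ?add_primes_new //; last first.
    exact: add_primes_prime_set.
  have QP := add_primes_prime_set P N k PP.
  have g0 := gen_euler_const_ge0 _ QP.
  have /andP[d0 d1] := sieve_prod_itv _ QP.
  have f1 : 1 - (N + k.+1)%:R^-1 <= 1 :> R by rewrite gerBl invr_ge0 ler0n.
  have l0 : 0 <= ln (N + k.+1)%:R / (N + k.+1)%:R :> R.
    by rewrite divr_ge0 ?ler0n // ln_ge0 // ler1n addnS.
  apply: ler_ltD; first by rewrite ler_piMl.
  by apply: le_lt_trans (hN (N + k.+1)%N _); rewrite ?ler_piMl // addnS ltnS leq_addr.
have [k gk] : exists k, y < g k.
  pose w k := sieve_prod_nat N.+1 (N + k).+1.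
  have half_gt0 : 0 < 2^-1 :> R by rewrite invr_gt0.
  have wex : exists k, w k <= 2^-1 by exact: sieve_prod_nat_small.
  case: (ex_minnP wex) => -[|k] wk mink.
    by move: wk; rewrite /w addn0 /sieve_prod_nat big_geq // => ?; lra.
  exists k.+1; apply: lt_le_trans (gen_euler_const_add_primes_ge P N k.+1 N0 PP PN).
  rewrite /= -/(w k.+1).
  have wk' : 2^-1 < w k by rewrite ltNge; apply/negP => /mink; rewrite ltnn.
  have w4 : 4^-1 <= w k.+1.
    rewrite /w sieve_prod_natS ?addnS ?ltnS ?leq_addr // -/(w k).
    case: ifP => pp; last by rewrite mul1r; lra.
    have : (N + k).+1%:R^-1 <= 2^-1 :> R.
      by rewrite lef_pV2 ?posrE ?ltr0n // ler_nat prime_gt1.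
    move: (_%:R^-1) => i hi; nra.
  have w8 : 8^-1 <= w k.+1 * (1 - w k.+1) by nra.
  rewrite ltr_pdivrMr // in lnN.
  have l0 : 0 <= ln N%:R :> R by rewrite ln_ge0 // ler1n.
  have := ler_wpM2l (mulr_ge0 (ltW D0) l0) w8.
  by move: lnN; rewrite (mulrC (ln _)) => ? ?; lra.
case: (ex_minnP (ex_intro (fun k => y < g k) k gk)) => -[|m] gm minm.
  by have := lt_trans Py gm; rewrite ltxx.
have gm' : g m <= y by rewrite leNgt; apply/negP => /minm; rewrite ltnn.
exists (add_primes P N m.+1); first exact: add_primes_prime_set.
rewrite gm /=; case: (gS m) => h; rewrite -/(g m.+1); lra.
Unshelve. all: by end_near. Qed.

End Limits.

Theorem proposition2 (R : realType) :
  has_inf (gen_euler_consts R) /\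
  dense_in (gen_euler_consts R) `[inf (gen_euler_consts R), +oo[.
Proof.
have lb0 : has_lbound (gen_euler_consts R).
  by exists 0 => _ [P PP <-]; exact: gen_euler_const_ge0.
have hasG : has_inf (gen_euler_consts R).
  split=> //; exists (gen_euler_const R fset0); by exists fset0.
split; first exact: hasG.
split=> [g Gg|x].
  by rewrite /= in_itv /= andbT; exact: ge_inf.
rewrite /= in_itv /= andbT => infx B /nbhs_ballP[e /= e0 xB].
have e2 : 0 < e / 2 by rewrite divr_gt0.
have [_ [P PP <-] Plt] := inf_adherent e2 hasG.
have Pxe : gen_euler_const R P < x + e / 2.
  by apply: lt_le_trans Plt _; rewrite lerD2r.
have [Q QQ /andP[xQ Qx]] := gen_euler_const_just_above P _ _ PP Pxe e2.
exists (gen_euler_const R Q); split; first by exists Q.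
by apply: xB; rewrite /ball /= distrC gtr0_norm ?subr_gt0; lra.
Qed.
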